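(* Let $(L,\vee,\wedge)$ be a lattice and $a,b\in L$ with $a<b$, and assume that the interval $[a,b]$ is complemented. Let $c\in[a,b]$. Then the following hold: (i) $c\in(c^{ab})^{ab}$ and $\big((c^{ab})^{ab}\big)^{ab}=c^{ab}$; (ii) $(x^{ab},\le)$ is an antichain for every $x\in[a,b]$ if and only if $[a,b]$ does not contain a sublattice isomorphic to $\mathbf N_5$ containing $a$ and $b$; (iii) $(c^{ab},\le)$ is convex, i.e. if $d,e\in c^{ab}$, $f\in[a,b]$ and $d\le f\le e$ then $f\in c^{ab}$; (iv) if the mapping $x\mapsto(x^{ab})^{ab}$ from $[a,b]$ to $2^{[a,b]}$ is not injective, then the identity $(x^{ab})^{ab}\approx x$ is not satisfied in $[a,b]$.
   Context: Here $[a,b]=\{w\in L\mid a\le w\le b\}$. For $x\in[a,b]$, $x^{ab}:=\{y\in[a,b]\mid x\vee y=b\text{ and }x\wedge y=a\}$; for a subset $A\subseteq[a,b]$, $A^{ab}:=\{y\in[a,b]\mid x\vee y=b\text{ and }x\wedge y=a\text{ for all }x\in A\}$. Saying that $[a,b]$ is complemented means $x^{ab}\neq\emptyset$ for all $x\in[a,b]$. Singletons are identified with their unique element; the interval $[a,b]$ satisfies the identity $(x^{ab})^{ab}\approx x$ if $(x^{ab})^{ab}=\{x\}$ for all $x\in[a,b]$. $\mathbf N_5$ denotes the five-element non-modular (pentagon) lattice. An antichain is a poset in which any two distinct elements are incomparable. *)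

(* Defs.v *)
From HB Require Import structures.
From mathcomp Require Import all_boot all_order interval.
From mathcomp Require Import boolp classical_sets functions.

Set Implicit Arguments.
Unset Strict Implicit.
Unset Printing Implicit Defensive.

(* [order_scope] is opened last, so that [`|`] and [`&`] are the join and meet
   of the lattice (not union and intersection of sets) and [`[a, b]] is an
   [interval L], whose membership unfolds to [a <= x <= b]. *)
Local Open Scope classical_set_scope.
Local Open Scope order_scope.

Section Complements.
Context {disp : Order.disp_t} {L : latticeType disp}.
Implicit Types (a b x y : L) (A : set L).

(* x^{ab} *)
Definition complements a b x : set L :=
  [set y | [/\ y \in `[a, b], x `|` y = b & x `&` y = a]].

(* A^{ab} *)
Definition set_complements a b A : set L :=
  [set y | y \in `[a, b] /\
           forall x, A x -> x `|` y = b /\ x `&` y = a].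

Definition complemented a b : Prop :=
  forall x, x \in `[a, b] -> complements a b x !=set0.

Definition sublattice A : Prop :=
  forall x y, A x -> A y -> A (x `&` y) /\ A (x `|` y).

Definition sublattice_iso {disp' : Order.disp_t} (M : latticeType disp') A : Prop :=
  sublattice A /\ exists f : {lmorphism M -> L}, set_bij setT A f.

End Complements.

Definition antichain {disp : Order.disp_t} {P : porderType disp} (A : set P) : Prop :=
  forall x y, A x -> A y -> x <> y -> x >< y.

(* The pentagon: N5_0 < N5_p < N5_q < N5_1 and N5_0 < N5_r < N5_1, with N5_r
   incomparable to N5_p and N5_q. *)
Inductive N5 : Type := N5_0 | N5_p | N5_q | N5_r | N5_1.

Module N5Lattice.

Definition encode (x : N5) : 'I_5 :=
  match x with
  | N5_0 => inord 0 | N5_p => inord 1 | N5_q => inord 2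
  | N5_r => inord 3 | N5_1 => inord 4
  end.

Definition decode (i : 'I_5) : N5 := nth N5_0 [:: N5_0; N5_p; N5_q; N5_r; N5_1] i.

Lemma encodeK : cancel encode decode.
Proof. by case; rewrite /decode inordK. Qed.

HB.instance Definition _ := Countable.copy N5 (can_type encodeK).

Definition le (x y : N5) : bool :=
  match x, y with
  | N5_0, _ | _, N5_1 | N5_p, N5_p | N5_p, N5_q | N5_q, N5_q | N5_r, N5_r => true
  | _, _ => false
  end.

Definition meet (x y : N5) : N5 :=
  match x, y with
  | N5_1, z | z, N5_1 => z
  | N5_p, N5_p | N5_p, N5_q | N5_q, N5_p => N5_p
  | N5_q, N5_q => N5_q
  | N5_r, N5_r => N5_r
  | _, _ => N5_0
  end.

Definition join (x y : N5) : N5 :=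
  match x, y with
  | N5_0, z | z, N5_0 => z
  | N5_p, N5_p => N5_p
  | N5_p, N5_q | N5_q, N5_p | N5_q, N5_q => N5_q
  | N5_r, N5_r => N5_r
  | _, _ => N5_1
  end.

Fact display : Order.disp_t. Proof. exact: Order.Disp tt tt. Qed.

Fact le_refl : reflexive le. Proof. by case. Qed.
Fact le_anti : antisymmetric le. Proof. by case; case. Qed.
Fact le_trans : transitive le. Proof. by case; case; case. Qed.

HB.instance Definition _ :=
  Order.Le_isPOrder.Build display N5 le_refl le_anti le_trans.

Fact meetC : commutative meet. Proof. by case; case. Qed.
Fact joinC : commutative join. Proof. by case; case. Qed.
Fact meetA : associative meet. Proof. by case; case; case. Qed.
Fact joinA : associative join. Proof. by case; case; case. Qed.
Fact joinKI (y x : N5) : meet x (join x y) = x. Proof. by case: x; case: y. Qed.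
Fact meetKU (y x : N5) : join x (meet x y) = x. Proof. by case: x; case: y. Qed.
Fact leEmeet (x y : N5) : (x <= y) = (meet x y == x).
Proof. by apply/idP/eqP; case: x; case: y. Qed.

HB.instance Definition _ := Order.POrder_isLattice.Build display N5
  meetC joinC meetA joinA joinKI meetKU leEmeet.

End N5Lattice.
HB.export N5Lattice.

(* Main.v *)
Require Import Defs.
From HB Require Import structures.
From mathcomp Require Import all_boot all_order interval.
From mathcomp Require Import boolp classical_sets functions.

(** Being complements of each other in [a, b] is a symmetric relation, so
    A |-> A^{ab} is the polarity of that relation: an antitone map forming a
    Galois connection with itself. Part (i) is the usual extensivity of the
    double polar and the collapse of the triple polar to the simple one
    ([sub_set_complements2], [set_complements3]), applied to A = {c}.

    For (ii), two complements p < q of the same r span, together with a, b and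
    r, a pentagon: all meets and joins of incomparable elements among these five
    are a and b. So mapping N5 onto them is a lattice morphism. It is injective
    without any comparison of the remaining elements, because every nontrivial
    congruence of N5 identifies its p and q ([N5_lmorphism_inj]). Conversely, a
    copy of N5 inside [a, b] that contains a and b has them as its bottom and
    top, so the images of its p and q are comparable complements of the image of
    its r ([N5_comparable_complements]).

    Part (iii) holds because joins and meets with c are monotone and take the
    same value at both ends d and e. Part (iv) is the injectivity of x |-> {x},
    read contrapositively. *)

Import Order.TTheory.
Local Open Scope classical_set_scope.
Local Open Scope order_scope.

Set Implicit Arguments.
Unset Strict Implicit.
Unset Printing Implicit Defensive.

Section Galois.
Context {disp : Order.disp_t} {L : latticeType disp}.
Implicit Types (a b c x y : L) (A B : set L).

(** Reduces the complements of an element to the polar of a set, for which the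
    Galois connection is stated. *)
Lemma complements_set1 a b x : complements a b x = set_complements a b [set x].
Proof.
apply/seteqP; split => y /=; first by case=> ? ? ?; split=> // _ ->.
by case=> ? /(_ x erefl)[].
Qed.

(** The equations x `|` y = b and x `&` y = a alone confine x to [a, b]. *)
Lemma complements_itv a b x y : complements a b x y -> x \in `[a, b].
Proof. by case=> _ <- <-; rewrite in_itv /= leIl leUl. Qed.

Lemma set_complementsS a b A B :
  A `<=` B -> set_complements a b B `<=` set_complements a b A.
Proof. by move=> AB y [yab yB]; split=> // x /AB /yB. Qed.

(** Complementation is symmetric, so x \in A is a common complement of the
    common complements of A; A must lie in [a, b] since polars do. *)
Lemma sub_set_complements2 a b A : A `<=` [set` `[a, b]] ->
  A `<=` set_complements a b (set_complements a b A).
Proof.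
move=> Aab x Ax; split; first exact: Aab.
by move=> y [_ /(_ x Ax)]; rewrite joinC meetC.
Qed.

(** One inclusion applies the antitone polar to the extensivity of the double
    polar at A; the other is that extensivity at the polar of A. *)
Lemma set_complements3 a b A : A `<=` [set` `[a, b]] ->
  set_complements a b (set_complements a b (set_complements a b A)) =
  set_complements a b A.
Proof.
move=> Aab; apply/seteqP; split.
  exact/set_complementsS/sub_set_complements2.
by apply: sub_set_complements2 => x [].
Qed.

End Galois.

Lemma complements_convex (disp : Order.disp_t) (L : latticeType disp)
    (a b c d e f : L) :
  complements a b c d -> complements a b c e -> d <= f <= e ->
  complements a b c f.
Proof.
move=> [dab cdb cda] [eab ceb cea] /andP[df fe].
have fab : f \in `[a, b].
  move: dab eab; rewrite !in_itv /= => /andP[ad _] /andP[_ eb].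
  by rewrite (le_trans ad df) (le_trans fe eb).
move: (fab); rewrite in_itv /= => /andP[af fb].
split=> //; apply/le_anti.
(* c `|` f is squeezed between c `|` d = b and b, and dually for the meet. *)
- by rewrite leUx fb -cdb leUl leU2.
- by rewrite lexI af -cea leIl leI2.
Qed.

Lemma sublattice_range (disp disp' : Order.disp_t) (M : latticeType disp')
    (L : latticeType disp) (f : {lmorphism M -> L}) : sublattice (range f).
Proof.
move=> _ _ [x _ <-] [y _ <-]; rewrite -omorphI -omorphU.
by split; [exists (x `&` y) | exists (x `|` y)].
Qed.

(** N5 is subdirectly irreducible, its smallest nontrivial congruence being the
    one that identifies p and q. Concretely, each pair of distinct elements of N5
    is sent to {p, q} by one of four unary lattice polynomials, and identifying
    the pair identifies the values of the polynomial. *)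
Lemma N5_lmorphism_inj (disp : Order.disp_t) (L : latticeType disp)
    (f : {lmorphism N5 -> L}) : f N5_p <> f N5_q -> injective f.
Proof.
move=> fpq x y fxy.
have fI z u v : f u = f v -> f (z `&` u) = f (z `&` v).
  by move=> fuv; rewrite !omorphI /= fuv.
have fU z u v : f u = f v -> f (z `|` u) = f (z `|` v).
  by move=> fuv; rewrite !omorphU /= fuv.
(* p `|` (q `&` z) separates {0, p, r} from {q, 1}, and q `&` (p `|` z)
   separates {0, p} from {r, q, 1}. Only the pairs {0, p} and {q, 1} remain:
   they are first moved to {r, 1} by r `|` z and to {0, r} by r `&` z. *)
have fUI := fU N5_p _ _ (fI N5_q _ _ fxy).
have fIU := fI N5_q _ _ (fU N5_p _ _ fxy).
have fUIU := fU N5_p _ _ (fI N5_q _ _ (fU N5_r _ _ fxy)).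
have fIUI := fI N5_q _ _ (fU N5_p _ _ (fI N5_r _ _ fxy)).
by case: x y {fxy} fUI fIU fUIU fIUI => [] [] //= *; exfalso; apply: fpq.
Qed.

Section Pentagon.
Context {disp : Order.disp_t} {L : latticeType disp} {a b r p q : L}.
Hypotheses (rp : complements a b r p) (rq : complements a b r q) (pq : p <= q).

Definition pentagon (x : N5) : L :=
  match x with N5_0 => a | N5_p => p | N5_q => q | N5_r => r | N5_1 => b end.

Lemma pentagon_itv x : a <= pentagon x <= b.
Proof.
have : r \in `[a, b] := complements_itv rp.
case: rp rq => pab _ _ [qab _ _]; rewrite in_itv /= => rab.
have ab : a <= b by case/andP: rab; apply: le_trans.
by case: x; rewrite /= ?lexx ?ab.
Qed.

(** Comparable pairs are then settled by monotonicity, which leaves only the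
    pairs {p, r} and {q, r} in the proofs that meets and joins are preserved. *)
Lemma pentagon_le : {homo pentagon : x y / x <= y}.
Proof.
move=> x y; have /andP[ax xb] := pentagon_itv x.
have /andP[ay yb] := pentagon_itv y.
by case: x y ax xb ay yb => [] [].
Qed.

Lemma pentagonI : {morph pentagon : x y / x `&` y}.
Proof.
move=> x y; case: (boolP (x <= y)) => [xy|nxy].
  by rewrite (meet_l xy) (meet_l (pentagon_le xy)).
case: (boolP (y <= x)) => [yx|nyx].
  by rewrite (meet_r yx) (meet_r (pentagon_le yx)).
case: rp rq => _ _ rpa [_ _ rqa].
by case: x y nxy nyx => [] [] //= _ _; rewrite ?[_ `&` r]meetC ?rpa ?rqa.
Qed.

Lemma pentagonU : {morph pentagon : x y / x `|` y}.
Proof.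
move=> x y; case: (boolP (x <= y)) => [xy|nxy].
  by rewrite (join_r xy) (join_r (pentagon_le xy)).
case: (boolP (y <= x)) => [yx|nyx].
  by rewrite (join_l yx) (join_l (pentagon_le yx)).
case: rp rq => _ rpb _ [_ rqb _].
by case: x y nxy nyx => [] [] //= _ _; rewrite ?[_ `|` r]joinC ?rpb ?rqb.
Qed.

HB.instance Definition _ :=
  Order.isOrderMorphism.Build _ N5 _ L pentagon pentagon_le.
HB.instance Definition _ :=
  Order.isMeetLatticeMorphism.Build _ N5 _ L pentagon pentagonI.
HB.instance Definition _ :=
  Order.isJoinLatticeMorphism.Build _ N5 _ L pentagon pentagonU.

(** The pentagon is nondegenerate as soon as p and q differ, whatever r is. *)
Lemma comparable_complements_N5 : p <> q -> exists S : set L,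
  [/\ S `<=` [set` `[a, b]], sublattice_iso N5 S, S a & S b].
Proof.
move=> p_neq_q; pose f : {lmorphism N5 -> L} := pentagon.
exists (range f); split.
- by move=> _ [x _ <-]; rewrite /= in_itv; apply: pentagon_itv.
- split; first exact: sublattice_range.
  exists f; split=> //.
  have f_inj : injective f by apply: N5_lmorphism_inj.
  by move=> x y _ _; apply: f_inj.
- by exists N5_0.
- by exists N5_1.
Qed.

End Pentagon.

Lemma N5_comparable_complements (disp : Order.disp_t) (L : latticeType disp)
    (a b : L) (S : set L) :
  S `<=` [set` `[a, b]] -> sublattice_iso N5 S -> S a -> S b ->
  exists r p q, [/\ complements a b r p, complements a b r q & p < q].
Proof.
move=> Sab [_ [f [fS f_inj f_surj]]] Sa Sb.
have f_itv x : a <= f x <= b by have /Sab := fS x I; rewrite /= in_itv.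
(* The image of the bottom is below a, which is itself in the image, and above
   a, since the image lies in [a, b]; dually for the top. *)
have f0 : f N5_0 = a.
  have [x _ fx] := f_surj a Sa; apply/le_anti.
  by have /andP[-> _] := f_itv N5_0; rewrite -fx omorph_le.
have f1 : f N5_1 = b.
  have [x _ fx] := f_surj b Sb; apply/le_anti.
  by have /andP[_ ->] := f_itv N5_1; rewrite -fx omorph_le //; case: x {fx}.
have pq : f N5_p < f N5_q.
  rewrite lt_neqAle omorph_le // andbT; apply/eqP => /f_inj.
  by rewrite !in_setT => /(_ isT isT).
exists (f N5_r), (f N5_p), (f N5_q).
by split=> //; split; rewrite ?in_itv ?f_itv -?omorphI -?omorphU.
Qed.

Theorem proposition3p1 (disp : Order.disp_t) (L : latticeType disp) (a b : L)
    (hab : a < b) (hcompl : complemented a b) (c : L) (hc : c \in `[a, b]) :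
  (* (i) *)
  (set_complements a b (complements a b c) c /\
   set_complements a b (set_complements a b (complements a b c)) =
     complements a b c) /\
  (* (ii) *)
  ((forall x : L, x \in `[a, b] -> antichain (complements a b x)) <->
   ~ exists S : set L,
       [/\ S `<=` [set` `[a, b]], sublattice_iso N5 S, S a & S b]) /\
  (* (iii) *)
  (forall d e f : L,
     complements a b c d -> complements a b c e -> f \in `[a, b] ->
     d <= f <= e -> complements a b c f) /\
  (* (iv) *)
  (~ {in `[a, b] &, injective (fun x => set_complements a b (complements a b x))} ->
   ~ (forall x : L, x \in `[a, b] ->
        set_complements a b (complements a b x) = [set x])).
Proof.
split; last split; last split.
- split; last by rewrite complements_set1 set_complements3 // => _ ->.
  by rewrite complements_set1; apply: sub_set_complements2 => // _ ->.
- split=> [anti [S [Sab isoS Sa Sb]]|noN5 x _ y z xy xz yz].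
    have [r [p [q [rp rq pq]]]] := N5_comparable_complements Sab isoS Sa Sb.
    have rab := complements_itv rp.
    have /eqP p_neq_q := negbT (lt_eqF pq).
    by have := anti r rab p q rp rq p_neq_q; rewrite /Order.comparable (ltW pq).
  rewrite /Order.comparable; apply/negP => /orP[le_yz|le_zy]; apply: noN5.
    exact: comparable_complements_N5 xy xz le_yz yz.
  by apply: comparable_complements_N5 xz xy le_zy _ => /esym.
- by move=> d e f cd ce _; apply: complements_convex.
- move=> ninj idem; apply: ninj => x y xab yab.
  by rewrite (idem x xab) (idem y yab) => /seteqP[/(_ x erefl)].
Qed.
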